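(* The solution of the optimization problem over $\hat n\times\hat n$ matrices $\mathbf{Q}$ $$\min_{\mathbf{Q}}\ \mathbb{E}_{\mathcal{J}}\left(\mathrm{Tr}\left(\left(\mathbf{E}_{\mathcal{J}}^T\mathbf{Q}\mathbf{E}_{\mathcal{J}}\right)^{-1}\right)\right)\quad\text{s.t.}\quad \mathbf{Q}\succeq 0,\quad \mathrm{Tr}(\mathbf{Q})=m,$$ which represents a convex relaxation of the optimization problem with the same objective and the constraints $\mathbf{Q}\succeq 0$, $\mathrm{Tr}(\mathbf{Q})=m$, $\mathrm{rank}(\mathbf{Q})\le m$ (obtained by ignoring the rank constraint), is the $\hat n\times\hat n$ matrix $\frac{m}{\hat n}\mathbf{I}_{\hat n}$.
   Context: Here $m\le\hat n$ and $s$ (with $s\le\hat n$) are positive integers. $\mathcal{J}$ is a random nonempty subset (support) of $\{1,\dots,\hat n\}$ of cardinality at most $s$, such that distinct supports of the same cardinality are equally likely: $\Pr(\mathcal{J}=J)=P_c$ for every $J\subset\{1,\dots,\hat n\}$ with $|J|=c$, $c=1,\dots,s$, where $\sum_{c=1}^{s}\binom{\hat n}{c}P_c=1$. $\mathbb{E}_{\mathcal{J}}$ denotes expectation with respect to $\mathcal{J}$. For $J\subset\{1,\dots,\hat n\}$, $\mathbf{E}_J$ is the matrix obtained from the identity matrix $\mathbf{I}_{\hat n}$ by deleting the columns whose index is not in $J$. $\mathbf{Q}\succeq 0$ means that $\mathbf{Q}$ is positive semidefinite.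
   Formalization: (m/n̂)I is proved optimal in all cases, but to be the only solution only if n̂=1 or P_c>0 for some 2≤c≤s; otherwise (e.g. s=1, n̂≥2) the objective depends only on the diagonal of Q and other minimizers exist. The trace of the inverse of a singular matrix is taken as +∞. *)

(* Defs.v *)
From HB Require Import structures.
From mathcomp Require Export all_boot all_order all_algebra.
From mathcomp Require Export all_classical all_reals all_analysis.

Set Implicit Arguments.
Unset Strict Implicit.
Unset Printing Implicit Defensive.

Import Order.TTheory GRing.Theory Num.Theory.

Local Open Scope classical_set_scope.
Local Open Scope ring_scope.

(* Finite sets carry the discrete sigma-algebra, so that a random support is a
   random variable with values in {set 'I_n}. *)
HB.instance Definition _ (T : finType) := isPointed.Build {set T} finset.set0.

HB.instance Definition _ (T : finType) :=
  @isMeasurable.Build default_measure_display {set T} discrete_measurable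
    discrete_measurable0 discrete_measurableC discrete_measurableU.

Section Matrices.
Context {R : realType} {n : nat}.
Implicit Types (Q : 'M[R]_n) (J : {set 'I_n}).

Definition psd Q : Prop :=
  Q \is symmetricmx /\ forall x : 'cV[R]_n, 0 <= (x^T *m Q *m x) 0 0.

(* [enum_val] lists J in increasing order. *)
Definition Emx J : 'M[R]_(n, #|J|) :=
  colsub (fun k : 'I_#|J| => enum_val k) 1%:M.

(* [invmx A] is A when A is singular, hence the case distinction; +oo is the
   continuous extension of Tr (A^-1) from positive definite matrices A to all
   positive semidefinite ones. *)
Definition trinv k (A : 'M[R]_k) : \bar R :=
  if A \in unitmx then (\tr (invmx A))%:E else +oo%E.

Definition objective {d : measure_display} {Omega : measurableType d}
    (P : probability Omega R) (J : {RV P >-> {set 'I_n}}) Q : \bar R :=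
  (\int[P]_w trinv ((Emx (J w))^T *m Q *m Emx (J w)))%E.

Definition feasible (m : nat) : set 'M[R]_n :=
  [set Q | psd Q /\ \tr Q = m%:R].

Definition rank_feasible (m : nat) : set 'M[R]_n :=
  feasible m `&` [set Q | (\rank Q <= m)%N].

End Matrices.

Section Optimization.
Context {R : realType}.

Definition is_minimizer (V : Type) (f : V -> \bar R) (D : set V) (x : V) :=
  D x /\ forall y, D y -> (f x <= f y)%E.

(* [convex_function] is restricted to real-valued functions. *)
Definition ereal_convex_function (V : lmodType R) (D : set V)
    (f : V -> \bar R) :=
  forall (t : {i01 R}) (x y : V), D x -> D y ->
    (f (t%:num *: x + (1 - t%:num) *: y)%R
       <= t%:num%:E * f x + (1 - t%:num)%:E * f y)%E.

(* Minimizing f over D is a convex problem that relaxes minimizing f over C. *)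
Definition convex_relaxation (V : lmodType R) (f : V -> \bar R)
    (D C : set V) :=
  [/\ C `<=` D, convex_set D & ereal_convex_function D f].

End Optimization.

(* Main.v *)
(** For A positive definite, completing the square gives
      Tr (A^-1) = 2 Tr Y - Tr (Y^T A Y) + Tr ((Y - A^-1)^T A (Y - A^-1)),
    so Tr (A^-1) is a supremum of affine functions of A, hence convex. Taking
    Y = a I with a = n / m on each principal submatrix Q_J gives
      Tr (Q_J^-1) >= 2 a |J| - a^2 Tr Q_J.
    As every index lies in the support with the same probability p, the
    expectation of the right-hand side is 2 a n p - a^2 p Tr Q = a n p, which is
    the value of the objective at (m / n) I. Equality forces Q_J = (m / n) I for
    every support J of positive probability; when such supports of cardinality
    at least 2 occur they cover every pair of indices, which determines Q. *)
Require Import Defs.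
From mathcomp Require Import perm measurable_realfun ring lra.

Set Implicit Arguments.
Unset Strict Implicit.
Unset Printing Implicit Defensive.

Import Order.TTheory GRing.Theory Num.Theory.

Local Open Scope classical_set_scope.
Local Open Scope ring_scope.

(** * Positive semidefinite matrices and convexity of the trace of the inverse *)

Section PositiveSemidefinite.
Context {R : realType}.

Lemma symmetricmxP n (A : 'M[R]_n) : A \is symmetricmx <-> A^T = A.
Proof.
rewrite qualifE /= expr0 scale1r map_mx_id //.
by split=> [/eqP <-|->]; rewrite ?trmxK.
Qed.

(** The form is minimal at x, so its first-order variation along y = A x, which is 2 |y|^2, must
    vanish. *)
Lemma psd_ker n (A : 'M[R]_n) (x : 'cV[R]_n) :
  psd A -> (x^T *m A *m x) 0 0 = 0 -> A *m x = 0.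
Proof.
move=> [/symmetricmxP Asym Age0] xAx0.
set y := A *m x; pose a : R := (y^T *m y) 0 0.
pose b : R := (y^T *m A *m y) 0 0.
have b_ge0 : 0 <= b by exact: Age0.
have quad (r : R) : 0 <= 2 * r * a + r ^+ 2 * b.
  have := Age0 (x + r *: y).
  have -> : (x + r *: y)^T = x^T + r *: y^T by rewrite linearD linearZ.
  rewrite !mulmxDl !mulmxDr -!scalemxAl -!scalemxAr.
  have -> : x^T *m A = y^T by rewrite /y trmx_mul Asym.
  rewrite scalerA -(mulmxA _ A x) -/y.
  have -> : y^T *m x = x^T *m A *m x by rewrite /y trmx_mul Asym.
  rewrite -mulmxA -/y.
  have addE (M N : 'M[R]_1) : (M + N) 0 0 = M 0 0 + N 0 0 by rewrite mxE.
  have scaleE c (M : 'M[R]_1) : (c *: M) 0 0 = c * M 0 0 by rewrite mxE.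
  have xy0 : (x^T *m y) 0 0 = 0 by rewrite /y mulmxA.
  by rewrite !(addE, scaleE) xy0 -/a -/b => ?; lra.
have a0 : a = 0.
  have a_ge0 : 0 <= a.
    by rewrite /a mxE sumr_ge0 // => i _; rewrite mxE -expr2 sqr_ge0.
  have b1_gt0 : 0 < b + 1 by lra.
  (* The denominator is b + 1 because b may be 0; the value is then a negative multiple of a^2. *)
  have := quad (- a / (b + 1)).
  have -> : 2 * (- a / (b + 1)) * a + (- a / (b + 1)) ^+ 2 * b =
            - (a ^+ 2 * (b + 2) / (b + 1) ^+ 2).
    by field; rewrite gt_eqF.
  rewrite oppr_ge0 => le0; apply/eqP; rewrite -sqrf_eq0 eq_le sqr_ge0 andbT.
  rewrite pmulr_lle0 ?invr_gt0 ?exprn_gt0 // in le0.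
  by rewrite pmulr_lle0 // in le0; lra.
apply/matrixP => i j; rewrite ord1 [RHS]mxE.
move: a0; rewrite /a mxE => /eqP; rewrite psumr_eq0; last first.
  by move=> k _; rewrite mxE -expr2 sqr_ge0.
by move=> /allP/(_ i (mem_index_enum _)); rewrite mxE -expr2 sqrf_eq0 => /eqP.
Qed.

(** With [psd_unit_eq0], this lets the invertibility test in [trinv] be read as positive
    definiteness. *)
Lemma psd_unit n (A : 'M[R]_n) : psd A ->
  (forall x : 'cV[R]_n, (x^T *m A *m x) 0 0 = 0 -> x = 0) -> A \in unitmx.
Proof.
move=> psdA Ainj; rewrite -row_free_unit; apply: inj_row_free => v vA0.
by rewrite -[v]trmxK (Ainj v^T) ?trmx0 // trmxK vA0 mul0mx mxE.
Qed.

Lemma psd_unit_eq0 n (A : 'M[R]_n) (x : 'cV[R]_n) :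
  psd A -> A \in unitmx -> (x^T *m A *m x) 0 0 = 0 -> x = 0.
Proof.
by move=> psdA Au /(psd_ker psdA) Ax0; rewrite -(mulKmx Au x) Ax0 mulmx0.
Qed.

Lemma trmx_mul_colE n k (A : 'M[R]_n) (Z : 'M[R]_(n, k)) j :
  (Z^T *m A *m Z) j j = ((col j Z)^T *m A *m col j Z) 0 0.
Proof. by rewrite tr_col -row_mul !mxE; apply: eq_bigr => i _; rewrite !mxE. Qed.

Lemma psd_congr n k (A : 'M[R]_n) (Z : 'M[R]_(n, k)) :
  psd A -> psd (Z^T *m A *m Z).
Proof.
move=> [/symmetricmxP Asym Age0]; split.
  by apply/symmetricmxP; rewrite !trmx_mul trmxK Asym mulmxA.
by move=> x; have := Age0 (Z *m x); rewrite trmx_mul !mulmxA.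
Qed.

Lemma psd_diag_ge0 n (A : 'M[R]_n) i : psd A -> 0 <= A i i.
Proof.
move=> [_ /(_ (col i 1%:M))].
by rewrite -trmx_mul_colE trmx1 mul1mx mulmx1.
Qed.

Lemma psd_mxtrace_ge0 n (A : 'M[R]_n) : psd A -> 0 <= \tr A.
Proof. by move=> psdA; apply: sumr_ge0 => i _; exact: psd_diag_ge0. Qed.

(** The equality case of completing the square: the trace is the sum of the nonnegative values of
    the form at the columns of Z, and A is definite. *)
Lemma psd_mxtrace_eq0 n k (A : 'M[R]_n) (Z : 'M[R]_(n, k)) :
  psd A -> A \in unitmx -> \tr (Z^T *m A *m Z) = 0 -> Z = 0.
Proof.
move=> psdA Au /eqP; rewrite psumr_eq0 => [/allP tr0|i _]; last first.
  exact/psd_diag_ge0/psd_congr.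
apply/matrixP => i j; rewrite [RHS]mxE.
have := tr0 j (mem_index_enum _); rewrite trmx_mul_colE => /eqP.
by move=> /(psd_unit_eq0 psdA Au)/matrixP/(_ i 0); rewrite !mxE.
Qed.

Lemma psd_scalar n (a : R) : 0 <= a -> psd (a *: 1%:M : 'M[R]_n).
Proof.
move=> a_ge0; split; first by apply/symmetricmxP; rewrite linearZ /= trmx1.
move=> x; rewrite -scalemxAr mulmx1 -scalemxAl mxE mulr_ge0 // mxE sumr_ge0 //.
by move=> i _; rewrite mxE -expr2 sqr_ge0.
Qed.

Lemma quad_comb n (t u : R) (A B : 'M[R]_n) (x : 'cV[R]_n) :
  (x^T *m (t *: A + u *: B) *m x) 0 0 =
  t * (x^T *m A *m x) 0 0 + u * (x^T *m B *m x) 0 0.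
Proof. by rewrite mulmxDr mulmxDl -!scalemxAr -!scalemxAl !mxE. Qed.

Lemma psd_comb n (t u : R) (A B : 'M[R]_n) :
  0 <= t -> 0 <= u -> psd A -> psd B -> psd (t *: A + u *: B).
Proof.
move=> t0 u0 [/symmetricmxP sA pA] [/symmetricmxP sB pB]; split.
  by apply/symmetricmxP; rewrite linearD !linearZ /= sA sB.
by move=> x; rewrite quad_comb addr_ge0 // mulr_ge0.
Qed.

Lemma psd_comb_unit n (t u : R) (A B : 'M[R]_n) :
  0 < t -> 0 <= u -> psd A -> psd B -> A \in unitmx ->
  t *: A + u *: B \in unitmx.
Proof.
move=> t0 u0 psdA psdB Au; apply: psd_unit; first exact: psd_comb (ltW t0) _ _ _.
move=> x; rewrite quad_comb => /eqP.
rewrite paddr_eq0 ?mulr_ge0 ?(ltW t0) //; last 2 first.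
- exact: psdA.2.
- exact: psdB.2.
rewrite mulf_eq0 (gt_eqF t0) /= => /andP[/eqP xAx _].
exact: psd_unit_eq0 xAx.
Qed.

Lemma mxtrace_inv_square n (A Y : 'M[R]_n) : psd A -> A \in unitmx ->
  \tr (invmx A) = (2 * \tr Y - \tr (Y^T *m A *m Y)) +
                  \tr ((Y - invmx A)^T *m A *m (Y - invmx A)).
Proof.
move=> [/symmetricmxP Asym _] Au.
have -> : (Y - invmx A)^T = Y^T - invmx A by rewrite linearB /= trmx_inv Asym.
rewrite !mulmxBl !mulmxBr mulVmx // mul1mx.
rewrite -(mulmxA Y^T A (invmx A)) mulmxV // mulmx1 mul1mx.
rewrite !raddfB /= mxtrace_tr; ring.
Qed.

Lemma trinv_ge n (A Y : 'M[R]_n) : psd A ->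
  ((2 * \tr Y - \tr (Y^T *m A *m Y))%:E <= trinv A)%E.
Proof.
move=> psdA; rewrite /trinv; case: ifPn => [Au|_]; last exact: leey.
rewrite lee_fin (mxtrace_inv_square Y psdA Au) lerDl.
exact/psd_mxtrace_ge0/psd_congr.
Qed.

Lemma trinv_ge0 n (A : 'M[R]_n) : psd A -> (0 <= trinv A)%E.
Proof.
move=> psdA; have := trinv_ge 0 psdA.
by rewrite linear0 mulmx0 linear0 mulr0 subr0.
Qed.

Lemma trinv_convex n (t : {i01 R}) (A B : 'M[R]_n) : psd A -> psd B ->
  (trinv (t%:num *: A + (1 - t%:num) *: B)
     <= t%:num%:E * trinv A + (1 - t%:num)%:E * trinv B)%E.
Proof.
move=> psdA psdB.
have t_ge0 : 0 <= t%:num by [].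
have t_le1 : t%:num <= 1 by [].
move: (t%:num) t_ge0 t_le1 => {}t t_ge0 t_le1.
(* The endpoints are treated apart: there a possibly infinite [trinv] has coefficient 0, and 0 * +oo
   is 0. *)
have [->|t_neq0] := eqVneq t 0.
  by rewrite scale0r add0r subr0 scale1r mul0e add0e mul1e.
have [->|t_neq1] := eqVneq t 1.
  by rewrite subrr scale0r addr0 scale1r mul0e adde0 mul1e.
have t_gt0 : 0 < t by rewrite lt_neqAle eq_sym t_neq0.
have u_gt0 : 0 < 1 - t by rewrite subr_gt0 lt_neqAle t_neq1.
(* A singular matrix with positive coefficient makes the right-hand side +oo, as the other term is
   never -oo. *)
have [Au|Au] := boolP (A \in unitmx); last first.
  rewrite {2}/trinv (negbTE Au) gt0_muley ?lte_fin // addye ?leey //.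
  rewrite -ltNye (lt_le_trans ltNy0) // mule_ge0 ?trinv_ge0 //.
  by rewrite lee_fin ltW.
have [Bu|Bu] := boolP (B \in unitmx); last first.
  by rewrite {3}/trinv (negbTE Bu) gt0_muley ?lte_fin // {2}/trinv Au /= leey.
have Cu := psd_comb_unit t_gt0 (ltW u_gt0) psdA psdB Au.
rewrite /trinv Au Bu Cu -!EFinM -EFinD lee_fin.
(* For this Y the lower bound is attained at C; being affine in the matrix, it splits into the
   bounds for A and B. *)
set C := t *: A + _ in Cu *; pose Y := invmx C.
have psdC : psd C by apply: psd_comb => //; exact: ltW.
have := trinv_ge Y psdA; have := trinv_ge Y psdB.
rewrite /trinv Au Bu !lee_fin => leB leA.
have -> : \tr (invmx C) = t * (2 * \tr Y - \tr (Y^T *m A *m Y)) +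
                          (1 - t) * (2 * \tr Y - \tr (Y^T *m B *m Y)).
  rewrite [LHS](mxtrace_inv_square Y psdC Cu) subrr mulmx0 linear0 addr0 /C.
  rewrite mulmxDr mulmxDl -!scalemxAr -!scalemxAl mxtraceD !mxtraceZ; ring.
by rewrite lerD // ler_wpM2l // ltW.
Qed.

End PositiveSemidefinite.

(** * Scalar test matrices and principal submatrices *)

Section PrincipalSubmatrices.
Context {R : realType}.

Lemma trinv_ge_scalar n (A : 'M[R]_n) (a : R) : psd A ->
  ((2 * a * n%:R - a ^+ 2 * \tr A)%:E <= trinv A)%E.
Proof.
move=> psdA; have := trinv_ge a%:M psdA.
rewrite tr_scalar_mx mul_scalar_mx mul_mx_scalar !mxtraceZ mxtrace_scalar.
by rewrite -(mulr_natr a) !mulrA -expr2.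
Qed.

(** Equality makes the completed square vanish, so a I is the inverse of A. *)
Lemma trinv_eq_scalar n (A : 'M[R]_n) (a : R) : psd A ->
  trinv A = (2 * a * n%:R - a ^+ 2 * \tr A)%:E -> a *: A = 1%:M.
Proof.
move=> psdA; rewrite /trinv; case: ifPn => // Au [].
rewrite (mxtrace_inv_square a%:M psdA Au).
rewrite tr_scalar_mx mul_scalar_mx mul_mx_scalar !mxtraceZ mxtrace_scalar.
rewrite -(mulr_natr a) !mulrA -expr2 => /eqP.
rewrite -subr_eq0 addrAC subrr add0r => /eqP.
move=> /(psd_mxtrace_eq0 psdA Au)/eqP; rewrite subr_eq0 => /eqP aE.
by rewrite -mul_mx_scalar aE mulmxV.
Qed.

Lemma trinv_scalar n (b : R) : b != 0 ->
  trinv (b *: 1%:M : 'M[R]_n) = (b^-1 * n%:R)%:E.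
Proof.
move=> b_neq0; have bu : b *: (1%:M : 'M[R]_n) \in unitmx.
  by rewrite unitmxZ ?unitmx1 // unitfE.
by rewrite /trinv bu invmxZ // invmx1 mxtraceZ mxtrace1.
Qed.

Context {n : nat}.
Implicit Types (Q : 'M[R]_n) (A : {set 'I_n}).

Lemma Emx_congrE Q A k l :
  ((Emx A)^T *m Q *m Emx A) k l = Q (enum_val k) (enum_val l).
Proof.
rewrite /Emx mulmx_colsub mulmx1 trmx_mxsub trmx1 mul_rowsub_mx mul1mx.
by rewrite !mxE.
Qed.

Lemma Emx_congr_mxtrace Q A :
  \tr ((Emx A)^T *m Q *m Emx A) = \sum_(i in A) Q i i.
Proof.
by rewrite big_enum_val; apply: eq_bigr => k _; rewrite Emx_congrE.
Qed.

Lemma Emx_congr_scalar (b : R) A :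
  (Emx A)^T *m (b *: 1%:M) *m Emx A = b *: 1%:M.
Proof.
apply/matrixP => k l.
by rewrite Emx_congrE !mxE (inj_eq enum_val_inj).
Qed.

Lemma Emx_congr_comb (t u : R) (Q1 Q2 : 'M[R]_n) A :
  (Emx A)^T *m (t *: Q1 + u *: Q2) *m Emx A =
  t *: ((Emx A)^T *m Q1 *m Emx A) + u *: ((Emx A)^T *m Q2 *m Emx A).
Proof. by rewrite mulmxDr mulmxDl -!scalemxAr -!scalemxAl. Qed.

End PrincipalSubmatrices.

(** * Subsets of a finite set and sums over them *)

Lemma exists_superset (T : finType) (B : {set T}) c :
  (#|B| <= c <= #|T|)%N -> exists2 A : {set T}, B \subset A & #|A| = c.
Proof.
move=> /andP[Bc cT].
(* The missing elements are drawn from the complement of B; the number of choices is a positive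
   binomial coefficient. *)
have : (0 < #|[set X : {set T} | X \subset ~: B & #|X| == (c - #|B|)%N]|)%N.
  by rewrite cards_draws bin_gt0 [#|~: B|]cardsCs finset.setCK leq_sub2r.
rewrite card_gt0 => /set0Pn[X]; rewrite inE => /andP[XB /eqP Xc].
exists (B :|: X); first exact: finset.subsetUl.
rewrite cardsU Xc finset.setIC disjoint_setI0 ?cards0; last first.
  by rewrite finset.disjoints_subset.
by rewrite subn0 subnKC.
Qed.

(* Transposing i and i0 shows that the total weight of the sets containing i
   does not depend on i. *)
Lemma sum_card_weight (R : realType) (T : finType) (f : nat -> R) (i0 : T)
    (v : T -> R) :
  \sum_(A : {set T}) f #|A| * (\sum_(i in A) v i) =
  (\sum_(A : {set T} | i0 \in A) f #|A|) * \sum_i v i.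
Proof.
under eq_bigr do rewrite big_distrr /=.
rewrite (exchange_big_dep xpredT) //= big_distrr; apply: eq_bigr => i _ /=.
rewrite -big_distrl /=; congr (_ * _).
have tinj := imset_inj (@perm_inj _ (tperm i0 i)).
rewrite (reindex_inj tinj) /=; apply: eq_big => A.
  by rewrite -{1}(tpermL i0 i) mem_imset //; exact: perm_inj.
by move=> _; rewrite card_imset //; exact: perm_inj.
Qed.

(** A strict inequality at one index would survive summation because the remaining lower bounds are
    finite. This passes from equality in expectation to equality at each support. *)
Lemma le_sume_eq (R : realType) (I : finType) (F : I -> \bar R) (g : I -> R) :
  (forall i, ((g i)%:E <= F i)%E) -> (\sum_i F i <= (\sum_i g i)%:E)%E ->
  forall i, F i = (g i)%:E.
Proof.
move=> gF sumF i; apply/eqP; rewrite eq_le gF andbT leNgt; apply/negP => ltgF.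
move: sumF; rewrite leNgt => /negP; apply.
rewrite (bigD1 i) //= [X in (_ < X)%E](bigD1 i) //= EFinD -sumEFin.
by rewrite lte_leD ?sumEFin // -sumEFin lee_sum.
Qed.

(** * The objective as a finite weighted sum *)

Section Expectation.
Context {R : realType} {n : nat} {d : measure_display}
  {Omega : measurableType d} {P : probability Omega R}.
Variable J : {RV P >-> {set 'I_n}}.

(** The fibres of J form a finite measurable partition of [Omega], and the integrand is constant on
    each. *)
Lemma integral_set_RV (f : {set 'I_n} -> \bar R) :
  (forall A, (0 <= f A)%E) ->
  (\int[P]_w f (J w) = \sum_A P (J @^-1` [set A]) * f A)%E.
Proof.
move=> f_ge0.
have mpre A : measurable (J @^-1` [set A]) by exact: measurable_funPTI.
have mf : measurable_fun [set: Omega] (fun w => f (J w)).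
  exact: (measurableT_comp (f := f)).
have -> : [set: Omega] = \big[setU/set0]_(A : {set 'I_n}) (J @^-1` [set A]).
  rewrite -bigcup_seq; apply/seteqP; split=> // w _.
  by exists (J w) => //=; rewrite mem_index_enum.
rewrite ge0_integral_bigsetU //=.
- apply: eq_bigr => A _; rewrite muleC -integral_cst //.
  by apply: eq_integral => w; rewrite inE /= => ->.
- exact: index_enum_uniq.
- by move=> A B _ _ [w [/= <- <-]].
- exact: measurable_funTS mf.
Qed.

Lemma objectiveE (Q : 'M[R]_n) : psd Q ->
  (objective J Q = \sum_A P (J @^-1` [set A]) *
                   trinv ((Emx A)^T *m Q *m Emx A))%E.
Proof.
move=> psdQ.
apply: (integral_set_RV (f := fun A => trinv ((Emx A)^T *m Q *m Emx A))).
by move=> A; exact/trinv_ge0/psd_congr.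
Qed.

Lemma objective_convex : ereal_convex_function psd (objective J).
Proof.
move=> t Q1 Q2 psdQ1 psdQ2.
have t_ge0 : 0 <= t%:num by [].
have u_ge0 : 0 <= 1 - t%:num by rewrite subr_ge0.
rewrite !objectiveE //; last exact: psd_comb.
have tr0 (Q : 'M[R]_n) A : psd Q -> (0 <= trinv ((Emx A)^T *m Q *m Emx A))%E.
  by move=> psdQ; exact/trinv_ge0/psd_congr.
rewrite !ge0_sume_distrr => [|A _|A _]; try by rewrite mule_ge0 ?tr0.
rewrite -big_split /=; apply: lee_sum => A _.
rewrite muleCA [X in (_ + X)%E]muleCA.
rewrite -ge0_muleDr ?mule_ge0 ?lee_fin ?tr0 //.
rewrite lee_wpmul2l // Emx_congr_comb.
by apply: trinv_convex; exact: psd_congr.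
Qed.

End Expectation.

(** * Optimality and uniqueness of the scalar matrix *)

Section Main.
Context {R : realType} {n m s : nat} {d : measure_display}
  {Omega : measurableType d} {P : probability Omega R}.
Variables (J : {RV P >-> {set 'I_n}}) (Pc : nat -> R).
Hypotheses (m_gt0 : (0 < m)%N) (m_le_n : (m <= n)%N).
Hypothesis J_card : forall w : Omega, (0 < #|J w| <= s)%N.
Hypothesis J_law : forall A : {set 'I_n}, (0 < #|A| <= s)%N ->
  P (J @^-1` [set A]) = (Pc #|A|)%:E.

(** [Pc] is arbitrary outside 1..s; extending it by 0 there lets sums range over all subsets, as
    [sum_card_weight] requires. *)
Let weight c : R := if (0 < c <= s)%N then Pc c else 0.

Lemma weightE A : P (J @^-1` [set A]) = (weight #|A|)%:E.
Proof.
rewrite /weight; case: ifPn => [|A_out]; first exact: J_law.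
rewrite -[RHS](measure0 P); congr (P _); apply/seteqP; split=> // w /= JwA.
by move: (J_card w); rewrite JwA (negbTE A_out).
Qed.

Lemma weight_ge0 (A : {set 'I_n}) : 0 <= weight #|A|.
Proof. by rewrite -lee_fin -weightE measure_ge0. Qed.

(** The inverse of the candidate matrix is a I. *)
Let a : R := n%:R / m%:R.

Lemma objective_scalar_sum : objective J (a^-1 *: 1%:M : 'M[R]_n) =
  (\sum_(A : {set 'I_n}) weight #|A| * (a * #|A|%:R))%:E.
Proof.
have a_gt0 : 0 < a by rewrite divr_gt0 ?ltr0n // (leq_trans m_gt0).
rewrite objectiveE; last by apply: psd_scalar; rewrite invr_ge0 ltW.
rewrite -sumEFin; apply: eq_bigr => A _.
rewrite weightE Emx_congr_scalar trinv_scalar ?invr_neq0 ?gt_eqF //.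
by rewrite invrK EFinM.
Qed.

Lemma weighted_bound_sum (Q : 'M[R]_n) : \tr Q = m%:R ->
  \sum_(A : {set 'I_n}) weight #|A| *
    (2 * a * #|A|%:R - a ^+ 2 * \tr ((Emx A)^T *m Q *m Emx A)) =
  \sum_(A : {set 'I_n}) weight #|A| * (a * #|A|%:R).
Proof.
move=> trQ.
have n_gt0 : (0 < n)%N by exact: leq_trans m_gt0 m_le_n.
have card_sum (A : {set 'I_n}) : #|A|%:R = \sum_(i in A) (1 : R).
  by rewrite sumr_const.
(* The bound at A is a |A| minus the sum of v over A, and v has total a^2 m - a n = 0. *)
pose v i := a ^+ 2 * Q i i - a.
transitivity (\sum_(A : {set 'I_n}) (weight #|A| * (a * #|A|%:R) -
                weight #|A| * \sum_(i in A) v i)).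
  apply: eq_bigr => A _; rewrite Emx_congr_mxtrace.
  by rewrite sumrB -mulr_sumr sumr_const -mulr_natr; ring.
rewrite sumrB (sum_card_weight weight (Ordinal n_gt0)).
have -> : \sum_i v i = 0.
  rewrite sumrB -mulr_sumr -/(mxtrace Q) trQ sumr_const card_ord -mulr_natr.
  by rewrite /a; field; rewrite pnatr_eq0 -lt0n.
by rewrite mulr0 subr0.
Qed.

Lemma weighted_bound (Q : 'M[R]_n) (A : {set 'I_n}) : psd Q ->
  ((weight #|A| * (2 * a * #|A|%:R -
      a ^+ 2 * \tr ((Emx A)^T *m Q *m Emx A)))%:E <=
   P (J @^-1` [set A]) * trinv ((Emx A)^T *m Q *m Emx A))%E.
Proof.
move=> psdQ; rewrite weightE EFinM lee_wpmul2l ?lee_fin ?weight_ge0 //.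
exact/trinv_ge_scalar/psd_congr.
Qed.

Lemma scalar_feasible : feasible m (a^-1 *: 1%:M : 'M[R]_n).
Proof.
split; first by apply: psd_scalar; rewrite invr_ge0 divr_ge0.
rewrite mxtraceZ mxtrace1 /a; field; rewrite !pnatr_eq0 -!lt0n m_gt0.
exact: leq_trans m_gt0 m_le_n.
Qed.

Lemma scalar_minimizer :
  is_minimizer (objective J) (feasible m) (a^-1 *: 1%:M : 'M[R]_n).
Proof.
split=> [|Q [psdQ trQ]]; first exact: scalar_feasible.
rewrite objective_scalar_sum -(weighted_bound_sum trQ) objectiveE // -sumEFin.
by apply: lee_sum => A _; exact: weighted_bound.
Qed.

(** Comparison with the candidate bounds the objective at Q by the sum of its own termwise lower
    bounds, so every term is an equality; a positive weight can be cancelled. *)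
Lemma minimizer_principal (Q : 'M[R]_n) (A : {set 'I_n}) :
  is_minimizer (objective J) (feasible m) Q -> 0 < weight #|A| ->
  a *: ((Emx A)^T *m Q *m Emx A) = 1%:M.
Proof.
move=> [[psdQ trQ] minQ] wA.
have := minQ _ scalar_feasible.
rewrite objective_scalar_sum -(weighted_bound_sum trQ) objectiveE //.
move=> /le_sume_eq-/(_ (fun A => weighted_bound A psdQ) A).
rewrite weightE EFinM => /(congr1 (fun x => (weight #|A|)^-1%:E * x)%E).
rewrite !muleA -EFinM mulVf ?gt_eqF // !mul1e.
by move=> /trinv_eq_scalar -> //; exact: psd_congr.
Qed.

Lemma minimizer_unique (Q : 'M[R]_n) c : (2 <= c <= s)%N -> (s <= n)%N ->
  0 < Pc c -> is_minimizer (objective J) (feasible m) Q ->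
  Q = a^-1 *: 1%:M.
Proof.
move=> /andP[c_ge2 c_le_s] s_le_n Pc_gt0 minQ.
have a_neq0 : a != 0.
  by rewrite mulf_neq0 ?invr_neq0 // pnatr_eq0 -lt0n // (leq_trans m_gt0).
have w_gt0 : 0 < weight c by rewrite /weight (ltnW c_ge2) c_le_s.
apply/matrixP => i j.
(* The pair has one or two elements, so c >= 2 leaves room for it, off-diagonal entries included. *)
have [|A ijA Ac] := @exists_superset _ [set i; j]%SET c.
  rewrite card_ord (leq_trans c_le_s s_le_n) andbT (leq_trans _ c_ge2) //.
  by rewrite cards2; case: (_ != _).
have Ai : i \in A by apply: (fintype.subsetP ijA); rewrite !inE eqxx.
have Aj : j \in A by apply: (fintype.subsetP ijA); rewrite !inE eqxx orbT.
have QA : a *: ((Emx A)^T *m Q *m Emx A) = 1%:M.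
  by apply: minimizer_principal => //; rewrite Ac.
have := congr1 (fun M : 'M[R]_(#|A|) =>
  M (enum_rank_in Ai i) (enum_rank_in Ai j)) QA.
rewrite mxE Emx_congrE !enum_rankK_in // => aQ.
rewrite -[LHS](mulKf a_neq0) aQ !mxE; congr (_ * _%:R).
by rewrite -(inj_eq enum_val_inj) !enum_rankK_in.
Qed.

End Main.

Lemma feasible_convex (R : realType) n m : convex_set (@feasible R n m).
Proof.
move=> Q1 Q2 t; rewrite !inE => -[psd1 tr1] [psd2 tr2].
have u_ge0 : 0 <= 1 - t%:num by rewrite subr_ge0.
split; first exact: (psd_comb _ u_ge0 psd1 psd2).
by rewrite mxtraceD !mxtraceZ tr1 tr2 -mulrDl addrC subrK mul1r.
Qed.

(** Uniqueness is conditional: if n > 1 and only singleton supports occur, the objective ignores the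
    off-diagonal entries, and small symmetric changes of them preserve optimality. *)
Theorem proposition1 (R : realType) (n m s : nat)
    (m_gt0 : (0 < m)%N) (m_le_n : (m <= n)%N)
    (s_gt0 : (0 < s)%N) (s_le_n : (s <= n)%N)
    (d : measure_display) (Omega : measurableType d) (P : probability Omega R)
    (J : {RV P >-> {set 'I_n}}) (Pc : nat -> R)
    (J_card : forall w : Omega, (0 < #|J w| <= s)%N)
    (J_law : forall A : {set 'I_n}, (0 < #|A| <= s)%N ->
       P (J @^-1` [set A]) = (Pc #|A|)%:E)
    (Pc_sum : \sum_(1 <= c < s.+1) 'C(n, c)%:R * Pc c = 1) :
  [/\ convex_relaxation (objective J) (feasible m) (rank_feasible m),
      is_minimizer (objective J) (feasible m) ((m%:R / n%:R) *: 1%:M)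
    & (n = 1%N \/ exists c : nat, (2 <= c <= s)%N /\ 0 < Pc c) ->
      forall Q : 'M[R]_n, is_minimizer (objective J) (feasible m) Q ->
        Q = (m%:R / n%:R) *: 1%:M].
Proof.
have aE : m%:R / n%:R = (n%:R / m%:R)^-1 :> R by rewrite invf_div.
split.
- split; first by move=> Q [].
  + exact: feasible_convex.
  + by move=> t Q1 Q2 [psd1 _] [psd2 _]; exact: objective_convex.
- by rewrite aE; exact: (scalar_minimizer m_gt0 m_le_n J_card J_law).
- case=> [n1 Q [[_ trQ] _]|[c [c_range Pc_gt0]] Q minQ].
    (* For n = 1 the trace constraint alone fixes the single entry. *)
    subst n; apply/matrixP => i j; move: trQ; rewrite /mxtrace big_ord1 !ord1.
    by rewrite divr1 !mxE mulr1.
  rewrite aE; exact: (minimizer_unique m_gt0 m_le_n J_card J_law c_range).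
Qed.
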